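(* Let $A$ be an $N\times N$ real symmetric matrix and $B$ an $N\times N$ real symmetric positive definite matrix. Let $\mu_{(A,j)}$ and $\mu_{(B,j)}$ denote the $j$-th smallest eigenvalues of $A$ and $B$, respectively. Assume that $\mu_{(B,1)}=1$, that either $\mu_{(A,1)}\ge0$ or $-\mu_{(A,N)}\le\mu_{(A,1)}<0$, and that $\gamma>\max(0,-\mu_{(A,1)})$. Let $0<\alpha<\frac{1}{\mu_{(A,N)}+\gamma}$. Then for almost every $x_0\in\mathbb{R}^N\setminus\{0\}$ (with respect to Lebesgue measure), the sequence $\{x_k\}$ generated by $$x_{k+1}=x_k-\alpha B^{-1}\nabla F_{A,B}(x_k),\qquad k=0,1,2,\dots,$$ converges to some $x_*$, where $(x_*,\lambda_* )$ is a solution pair of $Ax=\lambda Bx$ satisfying $$\sqrt{\langle Bx_*,x_*\rangle}=\|\sqrt{B}x_*\|=\frac{\gamma}{\gamma+\lambda_*}\quad\text{and}\quad \lambda_*=\min\{\lambda: A-\lambda B\text{ is singular}\}.$$ In fact, this iteration is the gradient descent of $F_{A,B}$ with respect to the inner product $\langle x,y\rangle_B:=x^TBy$; that is, for $x\ne0$, $B^{-1}\nabla F_{A,B}(x)$ is the gradient of $F_{A,B}$ at $x$ with respect to $\langle\cdot,\cdot\rangle_B$.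
   Context: $F_{A,B}:\mathbb{R}^N\to\mathbb{R}$ is defined by $F_{A,B}(x)=\frac12\langle x,Ax\rangle+\frac{\gamma}{2}\langle x,Bx\rangle-\gamma\sqrt{\langle x,Bx\rangle}$, with $\langle\cdot,\cdot\rangle$ the Euclidean inner product, and $\nabla$ is the Euclidean gradient; for $x\ne0$, $\nabla F_{A,B}(x)=Ax+\gamma\big(1-\frac{1}{\sqrt{\langle Bx,x\rangle}}\big)Bx$. $\sqrt B$ is the symmetric positive definite square root of $B$. A solution pair $(x,\lambda)$ of $Ax=\lambda Bx$ means $x\in\mathbb{R}^N\setminus\{0\}$, $\lambda\in\mathbb{R}$ with $Ax=\lambda Bx$. *)

(* Defs.v *)
From HB Require Import structures.
From mathcomp Require Export all_boot all_order all_algebra.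
From mathcomp Require Export all_classical all_reals all_analysis.

Set Implicit Arguments.
Unset Strict Implicit.
Unset Printing Implicit Defensive.

Export Order.TTheory GRing.Theory Num.Theory.
Export numFieldNormedType.Exports.

Local Open Scope classical_set_scope.
Local Open Scope ring_scope.

Definition dot (R : realType) (N : nat) (x y : 'cV[R]_N) : R :=
  \sum_(i < N) x i 0 * y i 0.

(* The norm `|x| of the library on matrices is the sup norm. *)
Definition enorm (R : realType) (N : nat) (x : 'cV[R]_N) : R :=
  Num.sqrt (dot x x).

Definition dotB (R : realType) (N : nat) (B : 'M[R]_N) (x y : 'cV[R]_N) : R :=
  (x^T *m B *m y) 0 0.

Definition symmetric_mx (R : realType) (N : nat) (A : 'M[R]_N) : Prop :=
  A^T = A.

Definition spd_mx (R : realType) (N : nat) (B : 'M[R]_N) : Prop :=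
  symmetric_mx B /\ forall x : 'cV[R]_N, x != 0 -> 0 < dot x (B *m x).

(* Nondecreasing list of the eigenvalues of A with algebraic multiplicity: it
   is unique when char_poly A splits over R, as it does for a symmetric A. *)
Definition spectrum (R : realType) (N : nat) (A : 'M[R]_N) : seq R :=
  xget [::] [set s : seq R | sorted <=%R s /\
                             char_poly A = \prod_(a <- s) ('X - a%:P)].

(* The j-th smallest eigenvalue, counted from j = 1. *)
Definition eigval (R : realType) (N : nat) (A : 'M[R]_N) (j : nat) : R :=
  nth 0 (spectrum A) j.-1.

(* The symmetric positive definite square root; it exists and is unique when B
   is itself symmetric positive definite. *)
Definition sqrtmx (R : realType) (N : nat) (B : 'M[R]_N) : 'M[R]_N :=
  xget 0 [set S : 'M[R]_N | spd_mx S /\ S *m S = B].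

Definition singular_mx (R : realType) (N : nat) (M : 'M[R]_N) : Prop :=
  M \notin unitmx.

Definition solution_pair (R : realType) (N : nat) (A B : 'M[R]_N)
    (x : 'cV[R]_N) (lam : R) : Prop :=
  x != 0 /\ A *m x = lam *: (B *m x).

Definition is_min (R : realType) (S : set R) (m : R) : Prop :=
  S m /\ forall l, S l -> m <= l.

Definition F_AB (R : realType) (N : nat) (A B : 'M[R]_N) (gamma : R)
    (x : 'cV[R]_N) : R :=
  dot x (A *m x) / 2 + gamma / 2 * dot x (B *m x)
  - gamma * Num.sqrt (dot x (B *m x)).

(* The vector of partial derivatives; its value is unspecified at points where
   these do not exist. *)
Definition grad (R : realType) (N : nat) (F : 'cV[R]_N -> R) (x : 'cV[R]_N) :
    'cV[R]_N :=
  \col_(i < N) 'D_(delta_mx i 0 : 'cV[R]_N) F x.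

(* g represents the differential of F at x through the inner product ip. *)
Definition is_gradient (R : realType) (N : nat)
    (ip : 'cV[R]_N -> 'cV[R]_N -> R) (F : 'cV[R]_N -> R)
    (x g : 'cV[R]_N) : Prop :=
  differentiable F x /\ forall v : 'cV[R]_N, 'd F x v = ip g v.

Definition descent_step (R : realType) (N : nat) (A B : 'M[R]_N)
    (gamma alpha : R) (x : 'cV[R]_N) : 'cV[R]_N :=
  x - alpha *: (invmx B *m grad (F_AB A B gamma) x).

Definition descent_seq (R : realType) (N : nat) (A B : 'M[R]_N)
    (gamma alpha : R) (x0 : 'cV[R]_N) (k : nat) : 'cV[R]_N :=
  iter k (descent_step A B gamma alpha) x0.

(* Outer Lebesgue measure on R^N: infimum of the total volume of the countable
   covers by closed boxes. A set is Lebesgue-null iff this measure is 0. *)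
Definition box (R : realType) (N : nat) (a b : 'cV[R]_N) : set 'cV[R]_N :=
  [set x | forall i, a i 0 <= x i 0 <= b i 0].

Definition box_volume (R : realType) (N : nat) (a b : 'cV[R]_N) : R :=
  \prod_(i < N) (b i 0 - a i 0).

Definition lebesgue_outer (R : realType) (N : nat) (S : set 'cV[R]_N) : \bar R :=
  ereal_inf [set v : \bar R | exists a b : nat -> 'cV[R]_N,
    [/\ forall k i, a k i 0 <= b k i 0,
        S `<=` \bigcup_k box (a k) (b k) &
        v = (\sum_(0 <= k <oo) (box_volume (a k) (b k))%:E)%E]].

Definition lebesgue_ae (R : realType) (N : nat) (P : 'cV[R]_N -> Prop) : Prop :=
  lebesgue_outer [set x | ~ P x] = 0%E.

(* Main.v *)
From HB Require Import structures.
Require Import Defs.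
From mathcomp Require Import sesquilinear spectral complex ring lra.

Set Implicit Arguments.
Unset Strict Implicit.
Unset Printing Implicit Defensive.

Local Open Scope classical_set_scope.
Local Open Scope ring_scope.

(** Simultaneous diagonalization turns the iteration into a scalar one.  There
    is an invertible V with V^T B V = 1 and V^T A V = diag nu
    ([simultaneous_diag]); nu lists the generalized eigenvalues of A x = l B x,
    and in the coordinates y = V^T B x the B-norm is the Euclidean norm r.  The
    formula for the gradient ([grad_F_AB]) then makes the descent step diagonal:

      y_i  |->  (a_i + c / r) y_i,   a_i = 1 - alpha (gamma + nu_i),
                                     c = alpha gamma.

    The least eigenvalue of B is 1, so each nu_i is a Rayleigh quotient of A
    times a factor in ]0, 1]; with the assumptions on the spectrum of A this
    gives 0 < gamma + nu_i <= gamma + mu_(A,N), hence 0 < a_i < 1.  So all the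
    multipliers are positive, and no iterate vanishes.

    Let i0 be an index where nu is least, that is, where a is greatest, and
    suppose that the coordinate y_i0 of the starting point is not 0.  The ratio
    y_i / y_i0 is multiplied by (a_i + c/r) / (a_i0 + c/r) at each step.  It is
    constant if nu_i = nu_i0.  Otherwise it tends to 0 geometrically, because
    r >= c after one step, which bounds the multiplier away from 1
    ([cvg_ratio]).  Hence |y_i0| / r converges, and |y_i0| obeys an affine
    recurrence with slope a_i0 < 1 and a convergent inhomogeneous term, so it
    converges as well ([cvg_affine_recurrence]).  The limit is an eigenvector
    for nu_i0, of B-norm c / (1 - a_i0) = gamma / (gamma + nu_i0)
    ([descent_cvg]).  Since A - l B is singular exactly when l is one of the
    nu_i, nu_i0 is the least such l.

    The exceptional starting points all satisfy y_i0 = 0, the equation of a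
    hyperplane, and hyperplanes are Lebesgue-null ([hyperplane_null]).

    The diagonalization rests on the spectral theorem for real symmetric
    matrices ([real_spectral]), proved by deflation: a real eigenvalue comes
    from the spectral theorem over the complex numbers, and a reflection splits
    off a unit eigenvector.  It also yields the square root of B and the
    Rayleigh bounds in terms of [eigval]. *)

(** * The Euclidean inner product *)

Section Dot.
Variables (R : realType) (N : nat).
Implicit Types x y z : 'cV[R]_N.

Lemma dotE x y : dot x y = (x^T *m y) 0 0.
Proof. by rewrite !mxE; apply: eq_bigr => i _; rewrite !mxE. Qed.

Lemma tr_mul_dot x y : x^T *m y = (dot x y)%:M.
Proof. by rewrite dotE -mx11_scalar. Qed.

Lemma dotC x y : dot x y = dot y x.
Proof. by apply: eq_bigr => i _; rewrite mulrC. Qed.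

Lemma dotDl x y z : dot (x + y) z = dot x z + dot y z.
Proof. by rewrite !dotE linearD /= mulmxDl mxE. Qed.

Lemma dotZl a x y : dot (a *: x) y = a * dot x y.
Proof. by rewrite !dotE linearZ /= -scalemxAl mxE. Qed.

Lemma dotZr a x y : dot x (a *: y) = a * dot x y.
Proof. by rewrite !(dotC x) dotZl. Qed.

Lemma dotBl x y z : dot (x - y) z = dot x z - dot y z.
Proof. by rewrite -scaleN1r dotDl dotZl mulN1r. Qed.

Lemma dotBr x y z : dot x (y - z) = dot x y - dot x z.
Proof. by rewrite !(dotC x) dotBl. Qed.

Lemma dot_ge0 x : 0 <= dot x x.
Proof. by apply: sumr_ge0 => i _; rewrite -expr2 sqr_ge0. Qed.

Lemma dot_eq0 x : (dot x x == 0) = (x == 0).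
Proof.
apply/eqP/eqP => [|->]; last by apply: big1 => i _; rewrite mxE mul0r.
move=> h; apply/matrixP => i j; rewrite ord1 mxE.
have p k : true -> 0 <= x k 0 * x k 0 by rewrite -expr2 sqr_ge0.
have /eqP : x i 0 * x i 0 = 0 by apply: (psumr_eq0P p h).
by rewrite mulf_eq0 orbb => /eqP.
Qed.

Lemma dot_gt0 x : x != 0 -> 0 < dot x x.
Proof. by move=> x0; rewrite lt_def dot_eq0 x0 dot_ge0. Qed.

Lemma cV_neq0_coord x : x != 0 -> exists i, x i 0 != 0.
Proof.
move=> x0; apply/existsP; apply: contraR x0; rewrite negb_exists => /forallP h.
apply/eqP/matrixP => k j; rewrite ord1 mxE; apply/eqP.
by have := h k; rewrite negbK.
Qed.

Lemma dot_mulmx (M : 'M[R]_N) x y : dot x (M *m y) = dot (M^T *m x) y.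
Proof. by rewrite !dotE trmx_mul trmxK mulmxA. Qed.
End Dot.

(** * The spectral theorem for real symmetric matrices *)

(** A real symmetric matrix is Hermitian over the complex numbers, where it is
    diagonalizable with real diagonal entries; such an entry is a root of the
    characteristic polynomial, which has the same coefficients over both
    fields. *)
Lemma symmetric_eigenvalue (R : realType) (n : nat) (A : 'M[R]_n.+1) :
  symmetric_mx A -> exists r, eigenvalue A r.
Proof.
move=> symA; pose f := real_complex R.
pose AC : 'M[R[i]]_n.+1 := map_mx f A.
have hAC : AC \is hermsymmx.
  apply: realsym_hermsym.
    by apply/is_hermitianmxP; rewrite expr0 scale1r map_mx_id // map_trmx symA.
  apply/mxOverP => i j; rewrite mxE; apply/complex_realP; by exists (A i j).
have /hermitian_normalmx/orthomx_spectralP eA := hAC.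
have /mxOverP/(_ 0 0)/complex_realP[r er] := hermitian_spectral_diag_real hAC.
exists r; rewrite eigenvalue_root_char -(fmorph_root f) map_char_poly.
rewrite -/f -/AC -eigenvalue_root_char -[X in eigenvalue _ X]er.
apply/eigenvalueP; exists (row 0 (spectralmx AC)).
  rewrite {2}eA -row_mul !mulmxA mulmxV ?spectral_unit // mul1mx.
  by rewrite row_mul row_diag_mx -scalemxAl -rowE.
apply/eqP => z; have := spectral_unit AC.
rewrite -row_free_unit => /row_freeP[Q /(congr1 (row 0))].
rewrite row_mul z mul0mx => /rowP/(_ 0); rewrite !mxE eqxx => /eqP.
by rewrite eq_sym oner_eq0.
Qed.

(** The reflection in the hyperplane orthogonal to v - e exchanges e and v,
    because both have the same length. *)
Lemma orthogonal_extension (R : realType) (n : nat) (v e : 'cV[R]_n) :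
  dot v v = 1 -> dot e e = 1 ->
  exists H : 'M[R]_n, H^T *m H = 1%:M /\ H *m e = v.
Proof.
move=> v1 e1; pose u := v - e.
have [u0|u0] := eqVneq u 0.
  exists 1%:M; rewrite trmx1 !mul1mx; split=> //.
  by apply/esym/eqP; rewrite -subr_eq0 -/u u0.
have du : dot u u != 0 by rewrite dot_eq0.
have eu : dot u e = - (dot u u / 2).
  have -> : dot u u = dot v v - 2 * dot v e + dot e e.
    by rewrite /u dotBr !dotBl (dotC e v); ring.
  by rewrite v1 e1 /u dotBl e1; field.
pose H := 1%:M - (2 / dot u u) *: (u *m u^T).
have tH : H^T = H.
  by rewrite /H linearB linearZ /= trmx1 trmx_mul trmxK.
have WW : (u *m u^T) *m (u *m u^T) = dot u u *: (u *m u^T).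
  by rewrite !mulmxA -(mulmxA u) tr_mul_dot mul_mx_scalar -scalemxAl.
exists H; split.
  rewrite tH /H mulmxBl mul1mx mulmxBr mulmx1 -scalemxAl -scalemxAr WW.
  set W := u *m u^T; apply/matrixP => i j; rewrite !mxE.
  by field.
rewrite /H mulmxBl mul1mx -scalemxAl -mulmxA tr_mul_dot mul_mx_scalar eu scalerA.
rewrite (_ : _ * _ = -1); last by field.
by rewrite scaleN1r opprK /u addrC subrK.
Qed.

(** Deflation: an orthogonal H sends the first basis vector to a unit
    eigenvector, so that the first column of H^T A H, and by symmetry its first
    row, vanish off the diagonal; the induction applies to the remaining
    block. *)
Theorem real_spectral (R : realType) (n : nat) (A : 'M[R]_n) :
  symmetric_mx A ->
  exists (P : 'M[R]_n) (d : 'rV[R]_n),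
    P^T *m P = 1%:M /\ A = P *m diag_mx d *m P^T.
Proof.
elim: n A => [|n IHn] A symA.
  by exists 1%:M, 0; split; rewrite [LHS]flatmx0 [RHS]flatmx0.
have [r /eigenvalueP[w wA w0]] := symmetric_eigenvalue symA.
have w0' : w^T != 0 by rewrite -trmx0 (inj_eq trmx_inj).
pose s := Num.sqrt (dot w^T w^T).
have s0 : 0 < s by rewrite sqrtr_gt0 dot_gt0.
pose v := s^-1 *: w^T.
have v1 : dot v v = 1.
  rewrite /v dotZl dotZr -[dot _ _]sqr_sqrtr ?dot_ge0 // -/s.
  by field; exact: lt0r_neq0.
have Av : A *m v = r *: v.
  rewrite /v -scalemxAr -[in LHS]symA -trmx_mul wA linearZ /= !scalerA.
  by rewrite mulrC.
pose e : 'cV[R]_(1 + n) := delta_mx 0 0.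
have e1 : dot e e = 1.
  by rewrite dotE trmx_delta mul_delta_mx mxE !eqxx.
have [H [HH He]] := orthogonal_extension v1 e1.
have [M defM] : {M : 'M[R]_(1 + n) | M = H^T *m A *m H} by exists (H^T *m A *m H).
have symM : M^T = M by rewrite defM !trmx_mul trmxK symA mulmxA.
have Me : M *m e = r *: e.
  by rewrite defM -!mulmxA He Av -scalemxAr -He mulmxA HH mul1mx.
have ulM : ulsubmx M = r%:M.
  apply/matrixP => i j; rewrite !ord1 !mxE eqxx mulr1n.
  have := congr1 (fun X : 'cV[R]_(1 + n) => X (lshift n 0) 0) Me.
  rewrite /= /e -colE !mxE.
  by rewrite (_ : lshift n 0 = 0) ?eqxx ?mulr1 //; apply: val_inj.
have dlM : dlsubmx M = 0.
  apply/matrixP => i j; rewrite !ord1 !mxE.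
  have := congr1 (fun X : 'cV[R]_(1 + n) => X (rshift 1 i) 0) Me.
  rewrite /= /e -colE !mxE.
  by rewrite (_ : lshift n 0 = 0) ?mulr0 //; apply: val_inj.
have urM : ursubmx M = 0 by rewrite -symM -trmx_dlsub dlM trmx0.
have symD : symmetric_mx (drsubmx M) by rewrite /symmetric_mx trmx_drsub symM.
have [P [d [PP eD]]] := IHn _ symD.
have eM : M = block_mx r%:M 0 0 (P *m diag_mx d *m P^T).
  by rewrite -[LHS]submxK ulM urM dlM -eD.
pose Q : 'M[R]_(1 + n) := block_mx 1%:M 0 0 P.
have tQ : Q^T = block_mx 1%:M 0 0 P^T by rewrite tr_block_mx trmx1 !trmx0.
have QQ : Q^T *m Q = 1%:M.
  rewrite tQ /Q mulmx_block !(mulmx0, mul0mx, addr0, add0r) mulmx1 PP.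
  by rewrite -scalar_mx_block.
have QM : Q *m diag_mx (row_mx r%:M d) *m Q^T = M.
  rewrite eM diag_mx_row tQ /Q !mulmx_block !(mulmx0, mul0mx, addr0, add0r).
  rewrite mulmx1 mul1mx; congr block_mx.
  by apply/matrixP => i j; rewrite !ord1 !mxE eqxx.
have HH' : H *m H^T = 1%:M by apply: mulmx1C.
exists (H *m Q), (row_mx r%:M d); split.
  by rewrite trmx_mul mulmxA -(mulmxA _ _ H) HH mulmx1.
have -> : A = H *m M *m H^T.
  by rewrite defM !mulmxA HH' mul1mx -mulmxA HH' mulmx1.
by rewrite -QM trmx_mul !mulmxA.
Qed.

(** * Extreme eigenvalues, square roots and simultaneous diagonalization *)

Section Eigval.
Variables (R : realType) (N : nat).
Implicit Types (A B P : 'M[R]_N) (d : 'rV[R]_N).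

Lemma char_poly_orthodiag P d : P^T *m P = 1%:M ->
  char_poly (P *m diag_mx d *m P^T) = \prod_(i < N) ('X - (d 0 i)%:P).
Proof.
move=> PP; have PP' : P *m P^T = 1%:M by apply: mulmx1C.
have -> : \prod_(i < N) ('X - (d 0 i)%:P) = char_poly (diag_mx d).
  rewrite char_poly_trig ?diag_mx_is_trig //; apply: eq_bigr => i _.
  by rewrite mxE eqxx.
have eX : char_poly_mx (P *m diag_mx d *m P^T) =
    map_mx polyC P *m char_poly_mx (diag_mx d) *m map_mx polyC P^T.
  rewrite /char_poly_mx mulmxBr mulmxBl !map_mxM; congr (_ - _).
  by rewrite mul_mx_scalar -scalemxAl -map_mxM PP' map_mx1 scalemx1.
rewrite /char_poly eX !det_mulmx mulrAC -det_mulmx -map_mxM PP' map_mx1 det1.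
by rewrite mul1r.
Qed.

(** The choice made in [spectrum] is not vacuous: the diagonal entries of
    [real_spectral], once sorted, qualify. *)
Lemma spectrumP A : symmetric_mx A ->
  sorted <=%R (spectrum A) /\
  char_poly A = \prod_(a <- spectrum A) ('X - a%:P).
Proof.
move=> /real_spectral[P [d [PP eA]]].
apply: (@xgetPex _ [::] [set s : seq R | sorted <=%R s /\
  char_poly A = \prod_(a <- s) ('X - a%:P)]).
exists (sort <=%R [seq d 0 i | i <- enum 'I_N]); split.
  exact/sort_sorted/le_total.
rewrite eA char_poly_orthodiag // (perm_big _ (permEl (perm_sort _ _))) /=.
by rewrite big_map big_enum.
Qed.

Lemma eigval_root A r : symmetric_mx A -> root (char_poly A) r ->
  eigval A 1 <= r <= eigval A N.
Proof.
move=> /spectrumP[sS eS]; rewrite {1}eS root_prod_XsubC => rS.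
have sz : size (spectrum A) = N.
  by apply/eqP; rewrite -eqSS -(size_prod_XsubC _ id) -eS size_char_poly.
have iS : (index r (spectrum A) < N)%N by rewrite -[ltnRHS]sz index_mem.
have N0 : (0 < N)%N by apply: leq_trans iS.
rewrite -{1 2}(nth_index 0 rS) /eigval /=.
by apply/andP; split; apply: (sorted_leq_nth le_trans le_refl);
  rewrite // ?inE ?sz ?prednK // -ltnS prednK.
Qed.

Lemma dot_mulmx_orthodiag P d x :
  dot x ((P *m diag_mx d *m P^T) *m x) = \sum_i d 0 i * (P^T *m x) i 0 ^+ 2.
Proof.
rewrite -!mulmxA dot_mulmx /dot; apply: eq_bigr => i _.
by rewrite mul_diag_mx [X in _ * X]mxE mulrCA expr2.
Qed.

(** Rayleigh bounds: in an orthonormal eigenbasis the quadratic form of A is a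
    combination of the squared coordinates, with weights in the spectrum. *)
Lemma eigval_quadratic A x : symmetric_mx A ->
  eigval A 1 * dot x x <= dot x (A *m x) <= eigval A N * dot x x.
Proof.
move=> symA; have [P [d [PP eA]]] := real_spectral symA.
have PP' : P *m P^T = 1%:M by apply: mulmx1C.
have -> : dot x x = \sum_i (P^T *m x) i 0 ^+ 2.
  transitivity (dot (P^T *m x) (P^T *m x)).
    by rewrite dot_mulmx trmxK mulmxA PP' mul1mx.
  by apply: eq_bigr => i _; rewrite expr2.
have db i : eigval A 1 <= d 0 i <= eigval A N.
  apply: eigval_root => //; rewrite {1}eA char_poly_orthodiag //.
  by rewrite (bigD1 i) //= rootM root_XsubC eqxx.
rewrite {2 3}eA dot_mulmx_orthodiag !mulr_sumr.
by apply/andP; split; apply: ler_sum => i _; rewrite ler_wpM2r ?sqr_ge0 //;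
  case/andP: (db i).
Qed.

(** Take the square roots of the entries of an orthogonal diagonalization. *)
Lemma spd_sqrt_exists B : spd_mx B -> exists S : 'M[R]_N, spd_mx S /\ S *m S = B.
Proof.
move=> [symB posB]; have [P [d [PP eB]]] := real_spectral symB.
have PP' : P *m P^T = 1%:M by apply: mulmx1C.
have d0 i : 0 < d 0 i.
  have e0 : P *m delta_mx i 0 != 0 :> 'cV[R]_N.
    apply/eqP => /(congr1 (mulmx P^T)); rewrite mulmxA PP mul1mx mulmx0.
    by move/matrixP/(_ i 0)/eqP; rewrite !mxE !eqxx oner_eq0.
  have := posB _ e0; rewrite {1}eB dot_mulmx_orthodiag mulmxA PP mul1mx.
  rewrite (bigD1 i) //= big1 => [|j /negPf ji]; last first.
    by rewrite mxE ji mulr0n expr0n mulr0.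
  by rewrite !mxE !eqxx expr1n mulr1 addr0.
pose s : 'rV[R]_N := \row_i Num.sqrt (d 0 i).
exists (P *m diag_mx s *m P^T); split; last first.
  rewrite !mulmxA -(mulmxA _ P^T) PP mulmx1 -(mulmxA P) mulmx_diag eB.
  congr (_ *m diag_mx _ *m _); apply/rowP => i.
  by rewrite !mxE -expr2 sqr_sqrtr // ltW.
split=> [|x x0].
  by rewrite /symmetric_mx !trmx_mul trmxK tr_diag_mx mulmxA.
rewrite dot_mulmx_orthodiag.
have s0 i : 0 < s 0 i by rewrite mxE sqrtr_gt0.
have p i : true -> 0 <= s 0 i * (P^T *m x) i 0 ^+ 2.
  by rewrite mulr_ge0 ?sqr_ge0 // ltW.
rewrite lt_def sumr_ge0 // andbT; apply: contra x0 => /eqP h.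
have : P^T *m x = 0.
  apply/matrixP => i j; rewrite ord1 [RHS]mxE.
  have /eqP : s 0 i * (P^T *m x) i 0 ^+ 2 = 0 by apply: (psumr_eq0P p h).
  by rewrite mulf_eq0 (gt_eqF (s0 i)) expf_eq0 => /eqP.
by move/(congr1 (mulmx P)); rewrite mulmxA PP' mul1mx mulmx0 => ->.
Qed.

Lemma sqrtmxP B : spd_mx B -> spd_mx (sqrtmx B) /\ sqrtmx B *m sqrtmx B = B.
Proof.
move=> /spd_sqrt_exists.
exact: (@xgetPex _ 0 [set S : 'M[R]_N | spd_mx S /\ S *m S = B]).
Qed.

Lemma spd_unit B : spd_mx B -> B \in unitmx.
Proof.
move=> [symB posB]; rewrite -row_free_unit -kermx_eq0; apply/rowV0P => v.
move/sub_kermxP => vB; apply: contraTeq isT => v0.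
have /posB : v^T != 0 by rewrite -trmx0 (inj_eq trmx_inj).
by rewrite -{1}symB -trmx_mul vB dotE trmx0 mulmx0 mxE ltxx.
Qed.

(** With S the square root of B and Q an orthogonal matrix diagonalizing the
    symmetric matrix S^-1 A S^-1, take V = S^-1 Q. *)
Lemma simultaneous_diag A B : symmetric_mx A -> spd_mx B ->
  exists (V : 'M[R]_N) (nu : 'rV[R]_N),
    V^T *m B *m V = 1%:M /\ V^T *m A *m V = diag_mx nu.
Proof.
move=> symA /sqrtmxP; set S := sqrtmx B => -[spdS <-].
have uS := spd_unit spdS; have [symS _] := spdS.
have symSi : (invmx S)^T = invmx S by rewrite trmx_inv symS.
have symM : symmetric_mx (invmx S *m A *m invmx S).
  by rewrite /symmetric_mx !trmx_mul symSi symA mulmxA.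
have [Q [nu [QQ eM]]] := real_spectral symM.
exists (invmx S *m Q), nu; rewrite trmx_mul symSi; split.
  by rewrite !mulmxA mulmxKV // -!mulmxA mulKVmx.
rewrite -!mulmxA [A *m _]mulmxA [invmx S *m (_ *m _)]mulmxA.
by rewrite [invmx S *m (_ *m _)]mulmxA eM -!mulmxA QQ mulmx1 mulmxA QQ mul1mx.
Qed.

End Eigval.

(** * The gradient of F_AB *)

Section Gradient.
Variables (R : realType) (N : nat).
Implicit Types (x v : 'cV[R]_N) (A B M : 'M[R]_N).

Lemma is_diff_coord x i :
  is_diff x (fun y : 'cV[R]_N => y i 0 : R) (fun y : 'cV[R]_N => y i 0 : R).
Proof.
have lin : linear (fun y : 'cV[R]_N => y i 0 : R).
  by move=> a y z; rewrite !mxE.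
pose fM := GRing.isLinear.Build _ _ _ _ _ lin.
pose f : {linear 'cV[R]_N -> R} := HB.pack (fun y : 'cV[R]_N => y i 0) fM.
apply: DiffDef; first exact: differentiable_coord.
rewrite (_ : (fun y : 'cV[R]_N => _) = f) // diff_lin //.
exact: coord_continuous.
Qed.

Lemma is_diff_sum (V : normedModType R) (I : Type) (s : seq I)
    (f df : I -> V -> R) (x : V) : (forall i, is_diff x (f i) (df i)) ->
  is_diff x (fun y => \sum_(i <- s) f i y) (fun y => \sum_(i <- s) df i y).
Proof.
move=> h; elim: s => [|i s IHs].
  rewrite (_ : (fun y => _) = cst 0); last by apply/funext => y; rewrite big_nil.
  rewrite (_ : (fun y => _) = 0 :> (V -> R)); first exact: is_diff_cst.
  by apply/funext => y; rewrite big_nil.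
rewrite (_ : (fun y => _) = f i + (fun y => \sum_(i <- s) f i y)); last first.
  by apply/funext => y; rewrite big_cons.
rewrite (_ : (fun y => \sum_(i <- i :: s) df i y) =
             df i + (fun y => \sum_(i <- s) df i y)); last first.
  by apply/funext => y; rewrite big_cons.
exact: is_diffD.
Qed.

Lemma is_diff_dot x w :
  is_diff x (fun y : 'cV[R]_N => dot w y) (fun v => dot w v).
Proof.
apply: is_diff_sum => i; exact: (is_diffZ (w i 0) (is_diff_coord x i)).
Qed.

(** The differential is computed from coordinates by the Leibniz rule; the
    symmetry of M merges its two terms. *)
Lemma is_diff_quadratic M x : symmetric_mx M ->
  is_diff x (fun y : 'cV[R]_N => dot y (M *m y)) (fun v => 2 * dot (M *m x) v).
Proof.
move=> symM.
have eM i y : (M *m y) i 0 = dot (row i M)^T y.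
  by rewrite mxE; apply: eq_bigr => j _; rewrite !mxE.
have h i : is_diff x (fun y : 'cV[R]_N => y i 0 * (M *m y) i 0)
    (fun v => x i 0 * (M *m v) i 0 + (M *m x) i 0 * v i 0).
  have hM : is_diff x (fun y : 'cV[R]_N => (M *m y) i 0 : R)
              (fun y : 'cV[R]_N => (M *m y) i 0 : R).
    under eq_fun do rewrite eM; exact: is_diff_dot.
  exact: (is_diffM (is_diff_coord x i) hM).
apply: is_diff_eq (is_diff_sum (index_enum 'I_N) h) _.
apply/funext => v; rewrite big_split /= -/(dot x (M *m v)) -/(dot (M *m x) v).
by rewrite dot_mulmx symM mulr_natl mulr2n.
Qed.

(** The square root is differentiable at <x, B x> because x != 0 makes this
    quantity positive. *)
Lemma is_diff_F_AB A B gamma x : symmetric_mx A -> spd_mx B -> x != 0 ->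
  is_diff x (F_AB A B gamma)
    (fun v => dot (A *m x + (gamma * (1 - (Num.sqrt (dot x (B *m x)))^-1))
                            *: (B *m x)) v).
Proof.
move=> symA [symB posB] x0.
have dA := is_diff_quadratic x symA; have dB := is_diff_quadratic x symB.
pose q y := dot y (B *m y).
have ds : is_diff (q x) (@Num.sqrt R) ( *:%R^~ (2 * Num.sqrt (q x))^-1).
  have [dq <-] := is_derive1_sqrt (posB _ x0).
  have dsq : differentiable (@Num.sqrt R) (q x) by apply/derivable1_diffP.
  by apply: DiffDef => //; rewrite diff1E // derive1E.
have dF := is_diffB (is_diffD (is_diffZ 2^-1 dA) (is_diffZ (gamma / 2) dB))
  (is_diffZ gamma (is_diff_comp dB ds)).
rewrite (_ : F_AB A B gamma = 2^-1 *: (fun y => dot y (A *m y)) +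
   (gamma / 2) *: q - gamma *: (@Num.sqrt R \o q)); last first.
  by apply/funext => y; rewrite /F_AB mulrC.
apply: is_diff_eq dF _; apply/funext => v /=.
have s0 : Num.sqrt (q x) != 0 by rewrite gt_eqF // sqrtr_gt0 posB.
rewrite dotDl dotZl -/(q x).
rewrite [LHS](_ : _ = 2^-1 * (2 * dot (A *m x) v) + gamma / 2 * (2 * dot (B *m x) v)
  - gamma * ((2 * dot (B *m x) v) * (2 * Num.sqrt (q x))^-1)); last by [].
by field.
Qed.

Lemma grad_F_AB A B gamma x : symmetric_mx A -> spd_mx B -> x != 0 ->
  grad (F_AB A B gamma) x = A *m x +
    (gamma * (1 - (Num.sqrt (dot x (B *m x)))^-1)) *: (B *m x).
Proof.
move=> symA spdB x0; have [dF eF] := is_diff_F_AB gamma symA spdB x0.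
apply/matrixP => i j; rewrite ord1 mxE deriveE // eF.
move: (A *m x + _) => g; rewrite /dot (bigD1 i) //= [X in _ * X]mxE !eqxx mulr1.
rewrite big1 ?addr0 // => k /negPf ki.
by rewrite [X in _ * X]mxE ki mulr0.
Qed.

(** For a symmetric B, <B^-1 g, v>_B = <g, v>. *)
Lemma is_gradient_F_AB A B gamma x : symmetric_mx A -> spd_mx B -> x != 0 ->
  is_gradient (dotB B) (F_AB A B gamma) x
    (invmx B *m grad (F_AB A B gamma) x).
Proof.
move=> symA spdB x0; have [dF eF] := is_diff_F_AB gamma symA spdB x0.
split=> // v; rewrite eF -grad_F_AB // /dotB trmx_mul trmx_inv spdB.1.
by rewrite mulmxKV ?spd_unit // dotE.
Qed.

End Gradient.

(** * Hyperplanes are Lebesgue-null *)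

Section Null.
Variable R : realType.

Lemma box_volume_ge0 N (a b : 'cV[R]_N) :
  (forall i, a i 0 <= b i 0) -> 0 <= box_volume a b.
Proof. by move=> ab; apply: prodr_ge0 => i _; rewrite subr_ge0. Qed.

Lemma lebesgue_outer_ge0 N (S : set 'cV[R]_N) : (0 <= lebesgue_outer S)%E.
Proof.
apply: le_ereal_inf_tmp => _ [a [b [ab _ ->]]]; apply: nneseries_ge0 => k _ _.
by rewrite lee_fin box_volume_ge0.
Qed.

(** Padding a list by a default of value 0 turns its sum into a series. *)
Lemma nneseries_nth (T : Type) (x0 : T) (s : seq T) (f : T -> R) :
  f x0 = 0 -> (forall j, 0 <= f (nth x0 s j)) ->
  (\sum_(0 <= j <oo) (f (nth x0 s j))%:E = (\sum_(x <- s) f x)%:E)%E.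
Proof.
move=> f0 fs; rewrite (nneseries_split 0 (size s)) => [|k _]; last first.
  by rewrite lee_fin.
rewrite eseries0 ?adde0 => [|j js _]; last by rewrite nth_default ?f0.
by rewrite add0n (big_nth x0) -sumEFin.
Qed.

(** A countable family of finite lists of boxes is as good as a sequence of
    boxes: nat * nat is countable, and the lists are padded with degenerate
    boxes, whose volume is 0 in positive dimension. *)
Lemma lebesgue_outer_le N (S : set 'cV[R]_N) (e : R)
    (l : nat -> seq ('cV[R]_N * 'cV[R]_N)) : (0 < N)%N -> 0 <= e ->
  (forall m c, c \in l m -> forall i, c.1 i 0 <= c.2 i 0) ->
  (forall x, S x -> exists m, exists2 c, c \in l m & box c.1 c.2 x) ->
  (forall m, \sum_(c <- l m) box_volume c.1 c.2 <= e / (2 ^ m.+1)%:R) ->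
  (lebesgue_outer S <= e%:E)%E.
Proof.
move=> N0 e0 ord cov vol.
pose G m j := nth (0, 0) (l m) j.
pose f (c : 'cV[R]_N * 'cV[R]_N) := box_volume c.1 c.2.
have f0 : f (0, 0) = 0.
  by rewrite /f /box_volume (bigD1 (Ordinal N0)) //= subrr mul0r.
have Gord m j i : (G m j).1 i 0 <= (G m j).2 i 0.
  have [js|js] := ltnP j (size (l m)); first exact/ord/mem_nth.
  by rewrite /G nth_default.
have fG m j : 0 <= f (G m j) by apply: box_volume_ge0.
have /card_esym/ppcard_eqP[h] := card_nat2.
apply: (@le_trans _ _ (\sum_(0 <= k <oo) (f (G (h k).1 (h k).2))%:E)%E).
  apply: ereal_inf_lbound.
  exists (fun k => (G (h k).1 (h k).2).1), (fun k => (G (h k).1 (h k).2).2).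
  split=> // x /cov[m [c cl cx]]; exists (h^-1%FUN (m, index c (l m))) => //=.
  by rewrite invK ?inE //= /G nth_index.
rewrite nneseries_esumT => [|k]; last by rewrite lee_fin.
rewrite -(@reindex_esum _ _ _ setT setT h (fun p => (f (G p.1 p.2))%:E)) //.
rewrite -[setT](_ : setT `*`` (fun=> setT) = _); last by apply/seteqP; split.
have fG' m j : setT m -> setT j -> (0 <= (f (G m j))%:E)%E by rewrite lee_fin.
rewrite -(@esum_esum _ _ _ setT (fun=> setT) (fun m j => (f (G m j))%:E)) //.
rewrite -nneseries_esumT => [|m]; last by apply: esum_ge0 => j _; rewrite lee_fin.
apply: le_trans (epsilon_trick0 xpredT e0).
apply: lee_nneseries => [m _ _|m _].
  by apply: esum_ge0 => j _; rewrite lee_fin.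
rewrite -nneseries_esumT => [|j]; last by rewrite lee_fin.
by rewrite /G (nneseries_nth f0 (fG m)) lee_fin; apply: vol.
Qed.

(** Inside the cube of side 2 M, the hyperplane is the graph of a linear
    function x_i = sum_j c_j x_j of the other n coordinates, with Lipschitz
    constant L = sum_j |c_j| for the sup norm.  Cut the base of the cube into
    cells of side d = 1 / q.  The graph over a cell lies in a box of height
    2 L d, and there are (2 M q + 1)^n cells of base volume d^n, so the total
    volume is at most 2 L (2 M + 1)^n / q. *)
Lemma hyperplane_slab_cover n (w : 'cV[R]_n.+1) (i : 'I_n.+1) (M : nat) (e : R) :
  w i 0 != 0 -> 0 < e ->
  exists l : seq ('cV[R]_n.+1 * 'cV[R]_n.+1),
    [/\ forall c, c \in l -> forall k, c.1 k 0 <= c.2 k 0,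
        forall x, dot w x = 0 -> (forall k, `|x k 0| <= M%:R) ->
          exists2 c, c \in l & box c.1 c.2 x &
        \sum_(c <- l) box_volume c.1 c.2 <= e].
Proof.
move=> wi e0.
pose c (j : 'I_n) := - w (lift i j) 0 / w i 0.
pose L := \sum_j `|c j|.
have L0 : 0 <= L by apply: sumr_ge0.
(* The number of subdivisions: X <= q makes the total volume at most e. *)
pose X := 2 * L * (2 * M%:R + 1) ^+ n / e.
have X0 : 0 <= X.
  by rewrite divr_ge0 ?(ltW e0) // mulr_ge0 ?mulr_ge0 // exprn_ge0 //
    addr_ge0 // mulr_ge0.
pose q := (Num.bound X).+1.
have q0 : 0 < q%:R :> R by rewrite ltr0n.
pose K := (2 * M * q)%N.
pose d : R := q%:R^-1.
have d0 : 0 < d by rewrite invr_gt0.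
pose p (f : {ffun 'I_n -> 'I_K.+1}) j : R := (f j)%:R * d - M%:R.
pose a f : 'cV[R]_n.+1 := \col_k
  if unlift i k is Some j then p f j else \sum_j c j * p f j - L * d.
pose b f : 'cV[R]_n.+1 := \col_k
  if unlift i k is Some j then p f j + d else \sum_j c j * p f j + L * d.
have ai f : a f i 0 = \sum_j c j * p f j - L * d by rewrite mxE unlift_none.
have bi f : b f i 0 = \sum_j c j * p f j + L * d by rewrite mxE unlift_none.
have al f j : a f (lift i j) 0 = p f j by rewrite mxE liftK.
have bl f j : b f (lift i j) 0 = p f j + d by rewrite mxE liftK.
exists [seq (a f, b f) | f <- enum {: {ffun 'I_n -> 'I_K.+1}}]; split.
- move=> _ /mapP[f _ ->] k /=; case: (unliftP i k) => [j|] ->.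
    by rewrite al bl lerDl ltW.
  by rewrite ai bi lerD2l ge0_cp // mulr_ge0 // ltW.
- move=> x wx xM.
  have xi : x i 0 = \sum_j c j * x (lift i j) 0.
    have : w i 0 * x i 0 + \sum_j w (lift i j) 0 * x (lift i j) 0 = 0.
      by rewrite -[RHS]wx /dot [RHS](bigD1_ord i).
    move/eqP; rewrite addr_eq0 => /eqP h.
    apply: (mulfI wi); rewrite h mulr_sumr -sumrN; apply: eq_bigr => j _.
    by rewrite /c; field.
  pose t j := (x (lift i j) 0 + M%:R) * q%:R.
  have t0 j : 0 <= t j.
    have := xM (lift i j); rewrite ler_norml => /andP[? _].
    by rewrite /t mulr_ge0 // -lerBlDr sub0r.
  have tK j : (Num.truncn (t j) < K.+1)%N.
    rewrite ltnS -(ler_nat R); have /andP[tl _] := truncn_itv (t0 j).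
    apply: le_trans tl _.
    rewrite /K natrM ler_wpM2r // natrM mulr_natl mulr2n lerD2r.
    exact: le_trans (ler_norm _) (xM _).
  (* The cell of x; the last index K serves the coordinates equal to M. *)
  pose f : {ffun 'I_n -> 'I_K.+1} := [ffun j => Ordinal (tK j)].
  exists (a f, b f); first by apply: map_f; rewrite mem_enum.
  have pf j : 0 <= x (lift i j) 0 - p f j <= d.
    have /andP[h1 h2] := truncn_itv (t0 j); rewrite /p ffunE /=.
    have -> : x (lift i j) 0 = t j * d - M%:R.
      by rewrite /t /d mulfK ?addrK // gt_eqF.
    rewrite opprB addrA subrK -mulrBl; apply/andP; split.
      by rewrite mulr_ge0 ?subr_ge0 ?(ltW d0).
    by rewrite ger_pMl // lerBlDr addrC natr1 ltW.
  move=> k /=; case: (unliftP i k) => [j|] ->.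
    by rewrite al bl -lerBlDl -[p f j <= _]subr_ge0; apply: pf.
  rewrite ai bi xi -ler_distl -sumrB mulr_suml.
  apply: le_trans (ler_norm_sum _ _ _) _; apply: ler_sum => j _.
  rewrite -mulrBr normrM ler_wpM2l //.
  by have /andP[h1 h2] := pf j; rewrite ger0_norm.
- rewrite big_map /= big_enum /=.
  have bv f : box_volume (a f) (b f) = 2 * L * d * d ^+ n.
    rewrite /box_volume (bigD1_ord i) //= ai bi.
    rewrite (eq_bigr (fun=> d)) => [|j _]; last by rewrite al bl addrAC subrr add0r.
    by rewrite prodr_const card_ord; ring.
  rewrite (eq_bigr _ (fun f _ => bv f)) sumr_const card_ffun !card_ord.
  rewrite -[leLHS]mulr_natr natrX -!mulrA -exprMn.
  have dK : d * K.+1%:R <= 2 * M%:R + 1.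
    rewrite -natr1 /K !natrM mulrDr mulr1 /d mulrC mulfK ?gt_eqF // lerD2l.
    by rewrite invf_le1 // ler1n.
  apply: (@le_trans _ _ (2 * (L * (d * (2 * M%:R + 1) ^+ n)))).
    rewrite !ler_wpM2l // ?(ltW d0) // lerXn2r // nnegrE; last first.
      by rewrite addr_ge0 // mulr_ge0.
    by rewrite mulr_ge0 // ltW.
  have -> : 2 * (L * (d * (2 * M%:R + 1) ^+ n)) = X * e * d.
    by rewrite /X divfK ?gt_eqF //; ring.
  rewrite mulrAC -[leRHS]mul1r ler_wpM2r ?(ltW e0) // /d ler_pdivrMr // mul1r.
  by rewrite /q -natr1 (le_trans (ltW (archi_boundP X0))) // lerDl.
Qed.

(** The cubes of half side m exhaust the space; the part of the hyperplane in
    the m-th one is covered with total volume e / 2^(m+1). *)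
Lemma hyperplane_null N (w : 'cV[R]_N) : w != 0 ->
  lebesgue_outer [set x | dot w x = 0] = 0%E.
Proof.
move=> w0; have [i wi] := cV_neq0_coord w0.
case: N w i w0 wi => [w []//|n w i w0 wi].
apply/eqP; rewrite eq_le lebesgue_outer_ge0 andbT.
apply/lee_addgt0Pr => e e0; rewrite add0e.
have em0 m : 0 < e / (2 ^ m.+1)%:R by rewrite divr_gt0 // ltr0n expn_gt0.
have /choice[l lP] := fun m => hyperplane_slab_cover m wi (em0 m).
apply: (@lebesgue_outer_le _ _ _ l) => //; first exact: ltW.
- by move=> m; have [] := lP m.
- move=> x wx; pose s := \sum_k `|x k 0|; pose m := Num.bound s.
  have [_ /(_ x wx) cov _] := lP m; exists m; apply: cov => k.
  have s0 : 0 <= s by apply: sumr_ge0.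
  apply: le_trans (ltW (archi_boundP s0)).
  by rewrite /s (bigD1 k) //= lerDl sumr_ge0.
- by move=> m; have [] := lP m.
Qed.

Lemma lebesgue_outer_subset0 N (S T : set 'cV[R]_N) :
  S `<=` T -> lebesgue_outer T = 0%E -> lebesgue_outer S = 0%E.
Proof.
move=> ST T0; apply/eqP; rewrite eq_le lebesgue_outer_ge0 andbT -T0.
apply: ereal_inf_le_tmp => _ [a [b [ab Tab ->]]]; exists a, b; split=> //.
exact: subset_trans Tab.
Qed.

End Null.

(** * The diagonal iteration *)

Section Dynamics.
Variable R : realType.

Lemma cvg0_contraction (q : R) (u : nat -> R) : 0 <= q < 1 ->
  (forall k, `|u k.+1| <= q * `|u k|) -> u k @[k --> \oo] --> 0.
Proof.
move=> /andP[q0 q1] hu.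
have bnd k : `|u k| <= q ^+ k * `|u 0|.
  elim: k => [|k IHk]; first by rewrite mul1r.
  by apply: le_trans (hu k) _; rewrite exprS -mulrA ler_wpM2l.
apply/norm_cvg0P.
apply: (@squeeze_cvgr _ _ _ _ (fun=> 0) (fun k => q ^+ k * `|u 0|)).
- by apply: nearW => k; rewrite normr_ge0 bnd.
- exact: cvg_cst.
- rewrite -[X in _ --> X](mul0r `|u 0|); apply: cvgMr_tmp.
  by apply: cvg_expr; rewrite ger0_norm.
Qed.

(** Subtracting the fixed point l / (1 - a) leaves a contraction perturbed by
    a sequence that tends to 0. *)
Lemma cvg_affine_recurrence (a l : R) (u e : nat -> R) : 0 <= a < 1 ->
  (forall k, u k.+1 = a * u k + e k) -> e k @[k --> \oo] --> l ->
  u k @[k --> \oo] --> l / (1 - a).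
Proof.
move=> /andP[a0 a1] hu he; have a1' : 0 < 1 - a by rewrite subr_gt0.
apply/cvgrPdist_le => eps eps0.
pose h := eps / 2 * (1 - a).
have h0 : 0 < h by rewrite mulr_gt0 // divr_gt0.
have /cvgrPdist_le/(_ _ h0)[K _ hK] := he.
pose d k := u (K + k)%N - l / (1 - a).
have bnd k : `|d k| <= a ^+ k * `|d 0%N| + eps / 2.
  elim: k => [|k IHk]; first by rewrite mul1r lerDl divr_ge0 ?ltW.
  have -> : d k.+1 = a * d k + (e (K + k)%N - l).
    by rewrite /d addnS hu; field; rewrite gt_eqF.
  apply: le_trans (ler_normD _ _) _; rewrite normrM ger0_norm //.
  have := hK (K + k)%N (leq_addr _ _); rewrite /= distrC => e1.
  apply: le_trans (lerD (ler_wpM2l a0 IHk) e1) _.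
  rewrite [leLHS](_ : _ = a ^+ k.+1 * `|d 0%N| + eps / 2) //.
  by rewrite exprS /h; field.
have : (fun k => a ^+ k * `|d 0%N|) @ \oo --> 0.
  rewrite -[X in _ --> X](mul0r `|d 0%N|); apply: cvgMr_tmp.
  by apply: cvg_expr; rewrite ger0_norm.
have e20 : 0 < eps / 2 by rewrite divr_gt0.
move=> /cvgrPdist_le/(_ _ e20)[K' _ hK'].
exists (K + K')%N => // k /= Kk.
have -> : k = (K + (k - K))%N by rewrite subnKC // (leq_trans (leq_addr _ _) Kk).
have kK' : (K' <= k - K)%N by rewrite leq_subRL // (leq_trans (leq_addr _ _) Kk).
rewrite distrC -/(d _); apply: le_trans (bnd _) _.
rewrite [leRHS](splitr eps) lerD2r.
have := hK' _ kK'; rewrite /= sub0r normrN ger0_norm //.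
by rewrite mulr_ge0 // exprn_ge0.
Qed.

Section Iteration.
Variables (N : nat) (a : 'I_N -> R) (c : R) (y : nat -> 'cV[R]_N).
Hypothesis a01 : forall i, 0 < a i < 1.
Hypothesis c0 : 0 < c.
Let r k := Num.sqrt (dot (y k) (y k)).
Hypothesis y0 : y 0%N != 0.
Hypothesis step : forall k i, y k != 0 -> y k.+1 i 0 = (a i + c / r k) * y k i 0.

Let r_gt0 k : y k != 0 -> 0 < r k.
Proof. by move=> yk; rewrite sqrtr_gt0 dot_gt0. Qed.

Let factor_gt0 k i : y k != 0 -> 0 < a i + c / r k.
Proof.
by move=> yk; have /andP[ai _] := a01 i; rewrite addr_gt0 // divr_gt0 // r_gt0.
Qed.

Lemma iterate_neq0 k : y k != 0.
Proof.
elim: k => // k IHk; have [i yi] := cV_neq0_coord IHk.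
apply: contra yi => /eqP yS; have /esym/eqP := step i IHk.
by rewrite yS mxE mulf_eq0 gt_eqF ?factor_gt0.
Qed.

(** Each multiplier exceeds c / r, so the new norm exceeds (c / r) r = c. *)
Lemma iterate_norm_ge k : c <= r k.+1.
Proof.
have yk := iterate_neq0 k; have rk := r_gt0 yk.
rewrite -[c]ger0_norm ?(ltW c0) // -sqrtr_sqr ler_sqrt ?dot_ge0 //.
have -> : c ^+ 2 = \sum_i (c / r k * y k i 0) ^+ 2.
  under eq_bigr do rewrite exprMn.
  rewrite -mulr_sumr (_ : \sum_i _ = r k ^+ 2); last first.
    by rewrite sqr_sqrtr ?dot_ge0 //; apply: eq_bigr => i _; rewrite expr2.
  by field; rewrite gt_eqF.
apply: ler_sum => i _; rewrite -expr2 step // exprMn [leRHS]exprMn.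
rewrite ler_wpM2r ?sqr_ge0 //.
have /andP[ai _] := a01 i; have cr : 0 < c / r k by rewrite divr_gt0.
by rewrite lerXn2r ?nnegrE ?lerDr ?addr_ge0 ?ltW.
Qed.

Variable i0 : 'I_N.
Hypothesis amax : forall i, a i <= a i0.
Hypothesis yi0 : y 0%N i0 0 != 0.

Let t k := y k i0 0.
Let rho i k := y k i 0 / t k.
Let sigma i := if a i == a i0 then rho i 0%N else 0.

Let t_neq0 k : t k != 0.
Proof.
elim: k => // k IHk; rewrite /t step ?iterate_neq0 //.
by rewrite mulf_neq0 // gt_eqF // factor_gt0 // iterate_neq0.
Qed.

Let rho_step i k : rho i k.+1 = (a i + c / r k) / (a i0 + c / r k) * rho i k.
Proof.
have yk := iterate_neq0 k; rewrite /rho /t !step // -/(t k).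
have F0 := factor_gt0 i0 yk; have tk := t_neq0 k.
rewrite invfM mulrACA [in RHS]mulrA; ring.
Qed.

(** If a_i < a_i0, then c / r <= 1 bounds the multiplier of the ratio by
    (a_i + 1) / (a_i0 + 1) < 1; otherwise the ratio never changes. *)
Lemma cvg_ratio i : rho i k @[k --> \oo] --> sigma i.
Proof.
rewrite /sigma; have [ai|ai] := eqVneq (a i) (a i0).
  rewrite (_ : rho i = fun=> rho i 0%N); first exact: cvg_cst.
  apply/funext; elim => // k IHk; rewrite rho_step IHk ai divff ?mul1r //.
  by rewrite gt_eqF // factor_gt0 // iterate_neq0.
have lai : a i < a i0 by rewrite lt_neqAle ai amax.
have /andP[ai0 _] := a01 i; have /andP[aj0 _] := a01 i0.
(* The bound c / r <= 1 holds from the second iterate on. *)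
rewrite -(cvg_shiftS (rho i)) /=.
apply: (@cvg0_contraction ((a i + 1) / (a i0 + 1))).
  rewrite divr_ge0 ?addr_ge0 ?ltW //= ltr_pdivrMr ?mul1r ?ltrD2r //.
  by rewrite addr_gt0.
move=> k; have yk := iterate_neq0 k.+1; have rk := r_gt0 yk.
rewrite rho_step normrM ler_wpM2r // gtr0_norm ?divr_gt0 ?factor_gt0 //.
have x1 : c / r k.+1 <= 1 by rewrite ler_pdivrMr // mul1r iterate_norm_ge.
have x0 : 0 < c / r k.+1 by rewrite divr_gt0.
rewrite ler_pdivrMr ?factor_gt0 // mulrAC ler_pdivlMr ?addr_gt0 //.
by nra.
Qed.

Let S := Num.sqrt (\sum_i sigma i ^+ 2).

Let sigma0 : sigma i0 = 1.
Proof. by rewrite /sigma eqxx /rho divff. Qed.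

Let S_gt0 : 0 < S.
Proof.
rewrite sqrtr_gt0 (bigD1 i0) //= sigma0 expr1n.
by rewrite ltr_wpDr // sumr_ge0 // => i _; rewrite sqr_ge0.
Qed.

(** The sign of y_i0 never changes, and r = |y_i0| s where s, the norm of the
    vector of ratios, converges to S.  Hence |y_i0| is multiplied by a_i0 and
    increased by c / s at each step. *)
Lemma cvg_iterate : exists eps : R, [/\ `|eps| = 1 &
   forall i, y k i 0 @[k --> \oo] --> sigma i * (eps * (c / S / (1 - a i0)))].
Proof.
pose s k := Num.sqrt (\sum_i rho i k ^+ 2).
have rE k : r k = `|t k| * s k.
  rewrite -sqrtr_sqr -sqrtrM ?sqr_ge0 // mulr_sumr; congr Num.sqrt.
  by apply: eq_bigr => i _; rewrite /rho -exprMn [t k * _]mulrC divfK // expr2.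
have cs : s k @[k --> \oo] --> S.
  apply: continuous_cvg; first exact: sqrt_continuous.
  apply: cvg_big => [|i _]; first exact: add_continuous.
  apply: (@continuous_cvg _ _ _ _ _ _ (fun z : R => z ^+ 2)); last exact: cvg_ratio.
  exact: exprn_continuous.
pose eps := Num.sg (t 0%N).
have sgt k : Num.sg (t k) = eps.
  elim: k => // k IHk; have yk := iterate_neq0 k.
  by rewrite {1}/t step // sgrM gtr0_sg ?mul1r // factor_gt0.
have tE k : t k = eps * `|t k| by rewrite -(sgt k) -numEsg.
have ct : `|t k| @[k --> \oo] --> c / S / (1 - a i0).
  apply: (@cvg_affine_recurrence _ _ (fun k => `|t k|) (fun k => c / s k)).
  - by have /andP[/ltW -> ->] := a01 i0.
  - move=> k; have yk := iterate_neq0 k.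
    rewrite {1}/t step // normrM gtr0_norm ?factor_gt0 // -/(t k) rE.
    have tk : `|t k| != 0 by rewrite normr_eq0.
    have sk : s k != 0.
      by apply: contraTneq (r_gt0 yk); rewrite rE => ->; rewrite mulr0 ltxx.
    by field; rewrite sk tk.
  - by apply: cvgMl_tmp; apply: cvgV => //; rewrite gt_eqF.
exists eps; split=> [|i]; first by rewrite normr_sg t_neq0.
rewrite (_ : (fun k => _) = fun k => rho i k * (eps * `|t k|)); last first.
  by apply/funext => k; rewrite -tE /rho divfK.
apply: cvgM; first exact: cvg_ratio.
exact: cvgMl_tmp.
Qed.

(** The norm c / (1 - a_i0) is the one at which the multiplier a_i0 + c / r
    equals 1. *)
Lemma cvg_iterate_fixpoint : exists L : 'cV[R]_N,
  [/\ forall i, y k i 0 @[k --> \oo] --> L i 0,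
      forall i, a i != a i0 -> L i 0 = 0 &
      Num.sqrt (dot L L) = c / (1 - a i0)].
Proof.
have [eps [eps1 cy]] := cvg_iterate.
pose h := eps * (c / S / (1 - a i0)).
exists (\col_i (sigma i * h)); split=> [i|i /negPf ai|].
- by rewrite mxE; apply: cy.
- by rewrite mxE /sigma ai mul0r.
have -> : dot (\col_i (sigma i * h)) (\col_i (sigma i * h)) = S ^+ 2 * h ^+ 2.
  rewrite sqr_sqrtr; last by apply: sumr_ge0 => i _; rewrite sqr_ge0.
  by rewrite mulr_suml; apply: eq_bigr => i _; rewrite !mxE -expr2 exprMn.
rewrite -exprMn sqrtr_sqr normrM gtr0_norm // /h normrM eps1 mul1r gtr0_norm.
  by field; rewrite !gt_eqF // subr_gt0; have /andP[] := a01 i0.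
by rewrite !divr_gt0 // subr_gt0; have /andP[] := a01 i0.
Qed.

End Iteration.
End Dynamics.

(** * The descent in a generalized eigenbasis *)

Lemma cvg_mulmx (R : realType) (N : nat) (V : 'M[R]_N) (y : nat -> 'cV[R]_N)
    (L : 'cV[R]_N) : (forall i, y k i 0 @[k --> \oo] --> L i 0) ->
  V *m y k @[k --> \oo] --> V *m L.
Proof.
have Vcol z : V *m z = \sum_i z i 0 *: col i V.
  apply/matrixP => j k; rewrite !ord1 !mxE summxE; apply: eq_bigr => i _.
  by rewrite !mxE mulrC.
move=> hy; rewrite Vcol (_ : (fun k => _) = fun k => \sum_i y k i 0 *: col i V).
  apply: cvg_big => [|i _]; first exact: add_continuous.
  exact: cvgZr_tmp.
by apply/funext => k; rewrite Vcol.
Qed.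

Section GeneralizedEigenbasis.
Variables (R : realType) (N : nat) (A B V : 'M[R]_N) (nu : 'rV[R]_N).
Hypothesis symA : symmetric_mx A.
Hypothesis spdB : spd_mx B.
Hypothesis BV : V^T *m B *m V = 1%:M.
Hypothesis AV : V^T *m A *m V = diag_mx nu.

Let VtBV : V *m (V^T *m B) = 1%:M. Proof. exact: mulmx1C. Qed.
Let BVVt : B *m V *m V^T = 1%:M.
Proof. by apply: mulmx1C; rewrite mulmxA. Qed.

Lemma mulmx_eigenbasis : A *m V = B *m V *m diag_mx nu.
Proof. by rewrite -AV !mulmxA BVVt mul1mx. Qed.

Lemma eigenbasisK (x : 'cV[R]_N) : V *m (V^T *m B *m x) = x.
Proof. by rewrite mulmxA VtBV mul1mx. Qed.

Lemma eigenbasis_inj (y : 'cV[R]_N) : V *m y = 0 -> y = 0.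
Proof. by move=> h; rewrite -[y]mul1mx -BV -mulmxA h mulmx0. Qed.

Lemma dotB_eigenbasis (y : 'cV[R]_N) : dot (V *m y) (B *m (V *m y)) = dot y y.
Proof.
by rewrite !dotE trmx_mul !mulmxA -(mulmxA _ V^T) -(mulmxA _ _ V) BV mulmx1.
Qed.

(** The congruence by V turns A - l B into the diagonal matrix of the
    nu_i - l. *)
Lemma singular_pencil l :
  singular_mx (A - l *: B) <-> exists i, nu 0 i = l.
Proof.
have eD : V^T *m (A - l *: B) *m V = diag_mx (\row_i (nu 0 i - l)).
  rewrite mulmxBr mulmxBl AV -scalemxAr -scalemxAl BV.
  apply/matrixP => i j; rewrite !mxE.
  by case: eqP; rewrite ?mulr1n ?mulr1 ?mulr0n ?mulr0 ?subr0.
have [_ uV] := mulmx1_unit BV.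
have uE : (A - l *: B \in unitmx) = (diag_mx (\row_i (nu 0 i - l)) \in unitmx).
  by rewrite -eD !unitmx_mul unitmx_tr uV andbT.
rewrite /singular_mx uE unitmxE det_diag unitfE; split=> [|[i <-]].
  rewrite negbK prodf_seq_eq0 => /hasP[i _]; rewrite mxE subr_eq0 => /eqP <-.
  by exists i.
by rewrite negbK (bigD1 i) //= mxE subrr mul0r.
Qed.

Lemma eigenvector_solution_pair i (y : 'cV[R]_N) : y != 0 ->
  (forall j, nu 0 j != nu 0 i -> y j 0 = 0) ->
  solution_pair A B (V *m y) (nu 0 i).
Proof.
move=> y0 hy; split; first by apply: contra y0 => /eqP/eigenbasis_inj ->.
rewrite mulmxA mulmx_eigenbasis -mulmxA.
rewrite (_ : diag_mx nu *m y = nu 0 i *: y).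
  by rewrite -scalemxAr mulmxA.
apply/matrixP => j k; rewrite ord1 mul_diag_mx !mxE.
by have [->//|/hy ->] := eqVneq (nu 0 j) (nu 0 i); rewrite !mulr0.
Qed.

(** With v the i-th column of V, <v, B v> = 1 and <v, A v> = nu_i, so
    t = <v, v> works: t <= <v, B v> because the least eigenvalue of B is 1. *)
Lemma eigenbasis_bounds i : eigval B 1 = 1 ->
  exists t, [/\ 0 < t <= 1, eigval A 1 * t <= nu 0 i & nu 0 i <= eigval A N * t].
Proof.
move=> B1; pose v := col i V.
have vM (M : 'M[R]_N) : dot v (M *m v) = (V^T *m M *m V) i i.
  rewrite dotE /v tr_col mulmxA -!row_mul colE mulmxA.
  by rewrite -colE !mxE.
have vA : dot v (A *m v) = nu 0 i by rewrite vM AV mxE eqxx.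
have vB : dot v (B *m v) = 1 by rewrite vM BV mxE eqxx.
have /andP[vv _] := eigval_quadratic v spdB.1.
have /andP[A1 AN] := eigval_quadratic v symA.
exists (dot v v); rewrite -vA; split=> //.
rewrite -vB -{2}[dot v v]mul1r -B1 vv andbT dot_gt0 //.
apply/eqP => v0; move: vB; rewrite v0 /dot big1 => [/eqP|j _].
  by rewrite eq_sym oner_eq0.
by rewrite mxE mul0r.
Qed.

(** In the coordinates y, B^-1 A acts as diag nu, B^-1 B as the identity, and
    the B-norm of x is the Euclidean norm of y. *)
Lemma descent_step_eigenbasis gamma alpha (x : 'cV[R]_N) i : x != 0 ->
  let y := V^T *m B *m x in
  (V^T *m B *m descent_step A B gamma alpha x) i 0 =
  (1 - alpha * (gamma + nu 0 i) + alpha * gamma / Num.sqrt (dot y y)) * y i 0.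
Proof.
move=> x0 y; have xE : x = V *m y by rewrite eigenbasisK.
have r2 : dot x (B *m x) = dot y y by rewrite xE dotB_eigenbasis.
rewrite /descent_step grad_F_AB // r2; set r := Num.sqrt _.
have r0 : r != 0 by rewrite gt_eqF // sqrtr_gt0 -r2; apply: spdB.2.
have -> : V^T *m B *m (x - alpha *: (invmx B *m (A *m x +
    (gamma * (1 - r^-1)) *: (B *m x)))) =
    y - alpha *: (diag_mx nu *m y + (gamma * (1 - r^-1)) *: y).
  rewrite mulmxBr -/y -scalemxAr !mulmxA mulmxK ?spd_unit //.
  by rewrite mulmxDr -scalemxAr mulmxA -/y {1}xE !mulmxA -mulmxA -AV !mulmxA.
rewrite mul_diag_mx !mxE; field; exact: r0.
Qed.

End GeneralizedEigenbasis.

(** Apply [cvg_iterate_fixpoint] to y = V^T B x and map the limit back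
    by V. *)
Lemma descent_cvg (R : realType) (N : nat) (A B V : 'M[R]_N) (nu : 'rV[R]_N)
    (gamma alpha : R) (i0 : 'I_N) (x0 : 'cV[R]_N) :
  symmetric_mx A -> spd_mx B ->
  V^T *m B *m V = 1%:M -> V^T *m A *m V = diag_mx nu ->
  0 < gamma -> 0 < alpha ->
  (forall i, 0 < alpha * (gamma + nu 0 i) < 1) ->
  (forall i, nu 0 i0 <= nu 0 i) ->
  (V^T *m B *m x0) i0 0 != 0 ->
  (forall k, descent_seq A B gamma alpha x0 k != 0) /\
  exists L : 'cV[R]_N,
    [/\ descent_seq A B gamma alpha x0 k @[k --> \oo] --> V *m L,
        forall j, nu 0 j != nu 0 i0 -> L j 0 = 0 &
        Num.sqrt (dot L L) = gamma / (gamma + nu 0 i0)].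
Proof.
move=> symA spdB BV AV g0 al0 anu numin yi0.
pose x := descent_seq A B gamma alpha x0.
pose y k := V^T *m B *m x k.
have xE k : x k = V *m y k by rewrite (eigenbasisK BV).
have x0E k : y k != 0 -> x k != 0.
  by apply: contra => /eqP; rewrite /y => ->; rewrite mulmx0.
pose a i := 1 - alpha * (gamma + nu 0 i).
have a01 i : 0 < a i < 1.
  by have /andP[h1 h2] := anu i; rewrite subr_gt0 h2 ltrBlDr ltrDl h1.
have c0 : 0 < alpha * gamma by rewrite mulr_gt0.
have y0 : y 0%N != 0.
  by apply: contra yi0 => /eqP h; rewrite -/(x 0%N) -/(y 0%N) h mxE.
have step k i : y k != 0 ->
    y k.+1 i 0 = (a i + alpha * gamma / Num.sqrt (dot (y k) (y k))) * y k i 0.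
  move=> /x0E xk; rewrite /y /x /descent_seq iterS.
  by rewrite (descent_step_eigenbasis symA spdB BV AV).
have amax i : a i <= a i0 by rewrite lerD2l lerN2 ler_pM2l // lerD2l.
split=> [k|]; first exact/x0E/(iterate_neq0 a01 c0 y0 step).
have [L [cL L0 nL]] := cvg_iterate_fixpoint a01 c0 y0 step amax yi0.
exists L; split=> [|j nj|].
- rewrite (_ : (fun k => _) = fun k => V *m y k); last exact/funext.
  exact: cvg_mulmx.
- apply: L0; apply: contra nj => /eqP/addrI/oppr_inj.
  by move/(mulfI (lt0r_neq0 al0))/addrI ->.
- rewrite nL /a opprB addrC subrK -mulf_div divff ?mul1r ?gt_eqF //.
Qed.

Theorem corollary2 (R : realType) (N : nat) (A B : 'M[R]_N) (gamma alpha : R)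
    (hN : (0 < N)%N)
    (hA : symmetric_mx A)
    (hB : spd_mx B)
    (hB1 : eigval B 1 = 1)
    (hA1 : 0 <= eigval A 1 \/ - eigval A N <= eigval A 1 < 0)
    (hgamma : Num.max 0 (- eigval A 1) < gamma)
    (halpha0 : 0 < alpha)
    (halpha1 : alpha < 1 / (eigval A N + gamma)) :
  lebesgue_ae (fun x0 : 'cV[R]_N => x0 != 0 ->
    (forall k, descent_seq A B gamma alpha x0 k != 0) /\
    exists (xs : 'cV[R]_N) (lams : R),
      [/\ descent_seq A B gamma alpha x0 k @[k --> \oo] --> xs,
          solution_pair A B xs lams,
          Num.sqrt (dot (B *m xs) xs) = enorm (sqrtmx B *m xs),
          enorm (sqrtmx B *m xs) = gamma / (gamma + lams) &
          is_min [set l : R | singular_mx (A - l *: B)] lams])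
  /\
  (forall x : 'cV[R]_N, x != 0 ->
     is_gradient (dotB B) (F_AB A B gamma) x
       (invmx B *m grad (F_AB A B gamma) x)).
Proof.
have [V [nu [BV AV]]] := simultaneous_diag hA hB.
split=> [|x x0]; last exact: is_gradient_F_AB.
have [i0 _ numin] : exists2 i0, xpredT i0 & forall i, nu 0 i0 <= nu 0 i.
  case: (@arg_minP _ _ _ (Ordinal hN) xpredT (fun i => nu 0 i)) => // i _ h.
  by exists i => // j; apply: h.
have [g0 gA] : 0 < gamma /\ - eigval A 1 < gamma.
  by move: hgamma; rewrite gt_max => /andP[].
have nu_bounds i : 0 < gamma + nu 0 i <= gamma + eigval A N.
  have [t [/andP[t0 t1] h1 hN']] := eigenbasis_bounds hA hB BV AV i hB1.
  have m1N : eigval A 1 <= eigval A N.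
    by rewrite -(ler_pM2r t0); apply: le_trans hN'.
  have mN : 0 <= eigval A N by case: hA1 => [|/andP[]] *; lra.
  have nuN : nu 0 i <= eigval A N by apply: le_trans hN' _; rewrite ler_piMr.
  have nu1 : - gamma < nu 0 i.
    case: hA1 => [m1|/andP[_ m1]].
      apply: lt_le_trans h1; apply: (@lt_le_trans _ _ 0).
        by rewrite oppr_lt0.
      by rewrite mulr_ge0 // ltW.
    apply: lt_le_trans h1; rewrite ltrNl; apply: le_lt_trans gA.
    by rewrite -mulNr ler_piMr // oppr_ge0 ltW.
  by rewrite lerD2l nuN -ltrBlDl sub0r nu1.
have anu i : 0 < alpha * (gamma + nu 0 i) < 1.
  have /andP[h1 h2] := nu_bounds i; have h3 := lt_le_trans h1 h2.
  rewrite mulr_gt0 //=; apply: (@le_lt_trans _ _ (alpha * (gamma + eigval A N))).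
    by rewrite ler_pM2l.
  by move: halpha1; rewrite [eigval A N + _]addrC ltr_pdivlMr.
(* The coordinate y_i0 as a linear form. *)
pose w : 'cV[R]_N := B *m col i0 V.
have wE x : dot w x = (V^T *m B *m x) i0 0.
  by rewrite /w dotE trmx_mul hB.1 tr_col -!row_mul mxE.
have w0 : w != 0.
  apply/eqP => w0; have := wE (col i0 V).
  rewrite w0 /dot big1 => [|j _]; last by rewrite mxE mul0r.
  rewrite colE mulmxA BV mul1mx !mxE !eqxx => /eqP.
  by rewrite eq_sym oner_eq0.
apply: lebesgue_outer_subset0 (hyperplane_null w0) => x0 /= nP.
apply: contrapT => wx; apply: nP => _.
have yi0 : (V^T *m B *m x0) i0 0 != 0 by rewrite -wE; apply/eqP.
have [neq [L [cL L0 nL]]] := descent_cvg hA hB BV AV g0 halpha0 anu numin yi0.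
split=> //; exists (V *m L), (nu 0 i0).
have [spdS SS] := sqrtmxP hB.
have nB : enorm (sqrtmx B *m (V *m L)) = Num.sqrt (dot (V *m L) (B *m (V *m L))).
  by rewrite /enorm dotC dot_mulmx spdS.1 mulmxA SS dotC.
split=> //.
- apply: (eigenvector_solution_pair BV AV) => //.
  have /andP[gn _] := nu_bounds i0.
  apply/eqP => L00; move: nL; rewrite L00 /dot big1 => [|j _]; last first.
    by rewrite mxE mul0r.
  by rewrite sqrtr0 => /esym/eqP; rewrite gt_eqF // divr_gt0.
- by rewrite nB dotC.
- by rewrite nB (dotB_eigenbasis BV).
- split=> [|l /= /(singular_pencil BV AV)[i <-] //].
  by apply/(singular_pencil BV AV); exists i0.
Qed.
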